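(* Let $R$ be a commutative finite chain ring of nilpotency index $e$ and residue field $\mathbb{F}_q$, and let $n$ be a positive integer such that $\gcd(n,q)=1$. Then \[c_n(R,1)=q^{e(n-1)}\prod_{d\mid n,\ d\neq 1}\left(1-q^{-\mathrm{ord}_d(q)}\right)^{\frac{\phi(d)}{\mathrm{ord}_d(q)}}.\]
   Context: A commutative finite chain ring (CFCR) is a finite commutative ring $R$ with identity $1\neq 0$ whose ideals are linearly ordered by inclusion. Its unique maximal ideal is principal; for a generator $\gamma$ of it, the nilpotency index of $R$ is the smallest positive integer $e$ with $\gamma^e=0$, and the residue field is $R/\gamma R\cong\mathbb{F}_q$ for a prime power $q$. An $n\times n$ circulant matrix over a commutative ring $S$ is a matrix $\mathrm{cir}(a_1,\dots,a_n)$ with first row $(a_1,a_2,\dots,a_n)$, $a_i\in S$, in which each subsequent row is the right cyclic shift of the previous row. For $a\in S$, $c_n(S,a)$ denotes the number of $n\times n$ circulant matrices over $S$ with determinant $a$. $\phi$ is Euler's totient function and $\mathrm{ord}_d(q)$ is the multiplicative order of $q$ modulo $d$. The product runs over positive divisors $d$ of $n$. *)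

(* Defs.v *)
From HB Require Import structures.
From mathcomp Require Import all_boot all_order all_fingroup all_algebra.

Set Implicit Arguments.
Unset Strict Implicit.
Unset Printing Implicit Defensive.

Import GRing.Theory.
Local Open Scope ring_scope.

Section ChainRings.
Variable R : finComNzRingType.

(* The library's [idealr_closed] excludes the unit ideal, which is allowed
   here. *)
Definition ideal (I : {set R}) : Prop :=
  [/\ 0 \in I, {in I &, forall x y, x + y \in I}
    & forall a, {in I, forall x, a * x \in I}].

Definition principal (g : R) : {set R} := [set g * x | x : R].

Definition maximal_ideal (M : {set R}) : Prop :=
  [/\ ideal M, M != [set: R]
    & forall J, ideal J -> M \subset J -> J = M \/ J = [set: R]].

Definition nilpotency_index (g : R) (e : nat) : Prop :=
  [/\ (0 < e)%N, g ^+ e = 0 & forall k, (0 < k)%N -> g ^+ k = 0 -> (e <= k)%N].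

End ChainRings.

Definition chain_ring (R : finComNzRingType) : Prop :=
  forall I J : {set R}, ideal I -> ideal J -> (I \subset J) || (J \subset I).

Section Circulant.
Variables (T : Type) (n : nat).

(* [ord_pred] is the cyclic predecessor in 'I_n, so this sends
   (a_1, ..., a_n) to (a_n, a_1, ..., a_(n-1)). *)
Definition cyclic_shift (v : 'rV[T]_n) : 'rV[T]_n :=
  \row_(j < n) v 0 (ord_pred j).

Definition cir (v : 'rV[T]_n) : 'M[T]_n :=
  \matrix_(i < n) iter i cyclic_shift v.

End Circulant.

Definition circulant_count (n : nat) (S : finComNzRingType) (a : S) : nat :=
  #|[set A : 'M[S]_n | (A \in codom (@cir S n)) && (\det A == a)]|.

(* Order of q in the unit group of Z/d, for 1 < d and q coprime to d;
   [insubd] defaults to the trivial unit when q is not invertible mod d. *)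
Definition mult_order (d q : nat) : nat :=
  #[insubd (1%g : {unit 'Z_d}) (q%:R : 'Z_d)]%g.

(* Main.v *)
(* Let f : R -> F be the reduction map. Units of R are the elements with
   nonzero residue, and |R| = q^e, |ker f| = q^(e-1). As n is invertible in R,
   the circulant 1 + (u-1)/n J (J the all-ones matrix) has determinant u for
   every unit u, so all unit determinants are equally frequent and
   c_n(R,1) |R^*| counts the circulants with unit determinant. This number is
   q^((e-1)n) times the number of invertible circulants over F, which are the
   residues mod X^n - 1 coprime to X^n - 1. By the Chinese remainder theorem
   they are counted factor by factor: X^n - 1 = \prod_(d | n) Phi_d is
   separable, and every irreducible factor of Phi_d over F has degree
   ord_d(q). *)
Require Import Defs.
From HB Require Import structures.
From mathcomp Require Import all_boot all_order all_fingroup all_algebra.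
From mathcomp Require Import all_field.

Set Implicit Arguments.
Unset Strict Implicit.
Unset Printing Implicit Defensive.
Import GRing.Theory.
Local Open Scope ring_scope.

(** * Counting the residues modulo a polynomial that are coprime to it *)

Section CoprimeResidues.
Variable F : finFieldType.
Implicit Types f g h p : {poly F}.

(** A residue modulo [f] is encoded by the coefficient row, of length deg f, of its remainder; for
    nonzero [f] the set stands for the units of F[X]/(f). *)
Definition coprime_residues f : {set 'rV[F]_(size f).-1} :=
  [set v | coprimep (rVpoly v) f].

Lemma dvdp_rVpoly f (v : 'rV[F]_(size f).-1) :
  f != 0 -> (f %| rVpoly v) = (v == 0).
Proof.
move=> f0; apply/idP/eqP => [dvd|->]; last by rewrite linear0 dvdp0.
apply: (can_inj rVpolyK); rewrite linear0; apply/eqP.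
apply: contraTT dvd => nz; apply/negP => /(dvdp_leq nz); apply/negP.
rewrite -ltnNge; apply: leq_ltn_trans (size_poly _ _) _.
by rewrite prednK // size_poly_gt0.
Qed.

Lemma card_coprime_residues_mul f g :
  f != 0 -> g != 0 -> coprimep f g ->
  #|coprime_residues (f * g)|
    = (#|coprime_residues f| * #|coprime_residues g|)%N.
Proof.
move=> f0 g0 cofg.
have sf : (0 < size f)%N by rewrite size_poly_gt0.
have sg : (0 < size g)%N by rewrite size_poly_gt0.
have sfg : (size (f * g)).-1 = ((size f).-1 + (size g).-1)%N.
  by rewrite size_mul // -[in LHS](prednK sf) -[in LHS](prednK sg) addSn addnS.
pose h (v : 'rV[F]_(size (f * g)).-1) :=
  (poly_rV (rVpoly v %% f) : 'rV[F]_(size f).-1,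
   poly_rV (rVpoly v %% g) : 'rV[F]_(size g).-1).
have modK (p u : {poly F}) : u != 0 ->
    rVpoly (poly_rV (p %% u) : 'rV[F]_(size u).-1) = p %% u.
  by move=> u0; rewrite poly_rV_K // -ltnS prednK ?size_poly_gt0 ?ltn_modp.
have h_inj : injective h.
  move=> v w [/(congr1 (@rVpoly _ _)) ef /(congr1 (@rVpoly _ _)) eg].
  rewrite !modK // in ef eg.
  have : f * g %| rVpoly v - rVpoly w.
    by rewrite Gauss_dvdp // /dvdp !modpD !modpN ef eg !subrr eqxx.
  by rewrite -raddfB dvdp_rVpoly ?mulf_neq0 // subr_eq0 => /eqP.
(* Chinese remaindering without an inverse: both sides have q^(deg f + deg g)
   elements, so injectivity suffices. *)
have h_bij : bijective h.
  apply: inj_card_bij h_inj _.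
  by rewrite card_prod !card_mx !mul1n sfg expnD.
(* Coprimality to [f * g] splits into coprimality to [f] and to [g], and each depends only on the
   corresponding remainder. *)
rewrite -cardsX -(card_imset _ h_inj); apply: eq_card => -[a b].
have [k hK kK] := h_bij.
rewrite -(kK (a, b)); move: (k (a, b)) => v.
rewrite (mem_imset _ _ h_inj) !inE /= !modK // coprimepMr.
rewrite ![coprimep (_ %% _) _]coprimep_sym !coprimep_modr.
by rewrite ![coprimep _ (rVpoly v)]coprimep_sym.
Qed.

Lemma card_coprime_residues_irreducible f :
  irreducible_poly f -> #|coprime_residues f| = (#|F| ^ (size f).-1).-1.
Proof.
move=> irr_f; have f0 := irredp_neq0 irr_f.
have -> : coprime_residues f = ~: [set 0].
  apply/setP=> v.
  by rewrite !inE coprimep_sym irreducible_poly_coprime // dvdp_rVpoly.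
by rewrite cardsC1 card_mx mul1n.
Qed.

(** Modulo a nonzero constant the only residue is 0, and it is coprime to that constant. This is the
    base case of the products below. *)
Lemma card_coprime_residues_const f : size f = 1 -> #|coprime_residues f| = 1%N.
Proof.
move=> sf; have -> : coprime_residues f = [set 0]; last exact: cards1.
apply/setP => v; rewrite !inE coprimep_sym.
have -> : v = 0.
  apply: (can_inj rVpolyK); apply/eqP; rewrite linear0 -size_poly_leq0.
  by apply: leq_trans (size_poly _ _) _; rewrite sf.
by rewrite linear0 coprimep0 -size_poly_eq1 sf !eqxx.
Qed.

Lemma irreducible_factor f :
  (1 < size f)%N -> exists2 g, irreducible_poly g & g %| f.
Proof.
have [n] := ubnP (size f); elim: n f => // n IHn f; rewrite ltnS => le_fn sf.
have [irrf|] := altP (irreducibleP f); first by exists f.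
rewrite /irreducibleb sf negb_forall => /existsP[g].
rewrite negb_imply -Pdiv.Idomain.dvdpE -ltnNge => /andP[gf sg].
have [|p irrp pg] := IHn (val g) _ sg.
  by rewrite (leq_ltn_trans (size_npoly g)) // prednK // ltnW.
by exists p => //; apply: dvdp_trans gf.
Qed.

(** Splitting off one irreducible factor at a time, separability makes it coprime to the cofactor,
    so each factor contributes q^m - 1. *)
Lemma card_coprime_residues_equidegree m f :
  (0 < m)%N -> separable_poly f ->
  (forall g, irreducible_poly g -> g %| f -> (size g).-1 = m) ->
  #|coprime_residues f| = ((#|F| ^ m).-1 ^ ((size f).-1 %/ m))%N.
Proof.
move=> m_gt0; have [n] := ubnP (size f); elim: n f => // n IHn f.
rewrite ltnS => le_fn sep deg; have f0 := separable_poly_neq0 sep.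
have [sf|sf] := leqP (size f) 1.
  have /eqP sf1 : size f == 1 by rewrite eqn_leq sf size_poly_gt0.
  by rewrite card_coprime_residues_const // sf1 div0n.
have [g irrg /dvdpP[h def_f]] := irreducible_factor sf.
have g0 := irredp_neq0 irrg.
have h0 : h != 0 by apply: contraNneq f0; rewrite def_f => ->; rewrite mul0r.
have sg : (size g).-1 = m by apply: deg => //; rewrite def_f dvdp_mull.
have Sg : size g = m.+1 by rewrite -sg prednK // size_poly_gt0.
have Sh : (0 < size h)%N by rewrite size_poly_gt0.
have sfE : (size f).-1 = ((size h).-1 + m)%N.
  by rewrite def_f size_mul // Sg -(prednK Sh) addnS.
have := sep; rewrite def_f separable_mul => /and3P[seph sepg cohg].
rewrite card_coprime_residues_mul // (card_coprime_residues_irreducible irrg).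
rewrite sg -def_f sfE divnDr // divnn m_gt0 addn1 expnSr; congr (_ * _)%N.
apply: IHn => //.
  apply: leq_trans le_fn.
  rewrite -(prednK Sh) -[ltnRHS]prednK ?size_poly_gt0 //.
  by rewrite sfE !ltnS -[ltnLHS]addn0 ltn_add2l.
by move=> p irrp ph; apply: deg => //; rewrite def_f dvdp_mulr.
Qed.

Lemma card_coprime_residues_prod (I : eqType) (s : seq I) (f : I -> {poly F}) :
  separable_poly (\prod_(i <- s) f i) ->
  #|coprime_residues (\prod_(i <- s) f i)|
    = (\prod_(i <- s) #|coprime_residues (f i)|)%N.
Proof.
elim: s => [|i s IHs].
  by rewrite !big_nil card_coprime_residues_const ?size_poly1.
rewrite !big_cons separable_mul => /and3P[sepi seps co].
by rewrite card_coprime_residues_mul ?IHs ?separable_poly_neq0.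
Qed.

End CoprimeResidues.

(** * Cyclotomic polynomials over a finite field and the degrees of their irreducible factors *)

Section CyclotomicFactors.
Variable F : finFieldType.
Implicit Types g : {poly F}.

Lemma card_pchar_nat : [pchar F].-nat #|F|.
Proof.
have [p p_pr pF] := finPcharP F.
rewrite (eq_pnat _ (pcharf_eq pF)) (card_pprimeChar pF : #|F| = _).
by rewrite pnatX pnat_id.
Qed.

Lemma coprime_card_natr_neq0 n : coprime n #|F| -> n%:R != 0 :> F.
Proof.
have [p p_pr pF] := finPcharP F; rewrite -(dvdn_pcharf pF).
apply: contraL => p_n; apply/negP => co.
have := card_pchar_nat; rewrite (eq_pnat _ (pcharf_eq pF)) => /p_natP[k Fk].
case: k Fk => [|k] Fk; first by have := finNzRing_gt1 F; rewrite Fk.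
have : (p %| gcdn n #|F|)%N by rewrite dvdn_gcd p_n Fk expnS dvdn_mulr.
by rewrite (eqP co) dvdn1 => /eqP p1; rewrite p1 in p_pr.
Qed.

Lemma separable_Xn_sub_1_card n :
  coprime n #|F| -> separable_poly ('X^n - 1 : {poly F}).
Proof. by move/coprime_card_natr_neq0; apply: separable_Xn_sub_1. Qed.

Lemma prod_map_Cyclotomic (K : comNzRingType) n : (0 < n)%N ->
  \prod_(d <- divisors n) map_poly (intr : int -> K) 'Phi_d = 'X^n - 1.
Proof.
move/prod_Cyclotomic/(congr1 (map_poly (intr : int -> K))).
by rewrite rmorph_prod rmorphB rmorph1 /= map_polyXn.
Qed.

(** If [z] had order m < n, it would also be a root of some Phi_d with d | m, hence a double root of
    the separable X^n - 1. *)
Lemma root_map_Cyclotomic (K : fieldType) n z : n%:R != 0 :> K ->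
  root (map_poly (intr : int -> K) 'Phi_n) z -> n.-primitive_root z.
Proof.
move=> n0 rz; have n_gt0 : (0 < n)%N by case: n n0 {rz} => //; rewrite eqxx.
have n_div : n \in divisors n by rewrite -dvdn_divisors.
have zn1 : z ^+ n = 1.
  apply/eqP; rewrite -subr_eq0.
  have: root ('X^n - 1) z.
    by rewrite -prod_map_Cyclotomic // (big_rem n) //= rootM rz.
  by rewrite /root !hornerE.
have [m prim_m m_n] := prim_order_exists n_gt0 zn1.
have [<- //|neq_mn] := eqVneq m n.
have m_gt0 := prim_order_gt0 prim_m.
have rm : root ('X^m - 1) z.
  by rewrite /root !hornerE (prim_expr_order prim_m) subrr.
have [d d_m rd] : exists2 d, d \in divisors m &
    root (map_poly (intr : int -> K) 'Phi_d) z.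
  have := rm; rewrite -prod_map_Cyclotomic // /root horner_prod prodf_seq_eq0.
  by case/hasP => d d_m /=; exists d.
have d_rem : d \in rem n (divisors n).
  rewrite (mem_rem_uniq _ (divisors_uniq n)) inE -!dvdn_divisors //= in d_m *.
  rewrite (dvdn_trans d_m m_n) andbT; apply: contraNneq neq_mn => d_n.
  by rewrite eqn_dvd m_n -d_n.
have := separable_Xn_sub_1 n0.
rewrite -prod_map_Cyclotomic // (big_rem n) //= separable_mul.
case/and3P=> _ _ /coprimep_root/(_ rz).
by rewrite horner_prod prodf_seq_neq0 => /allP/(_ d d_rem)/negP.
Qed.

(** The order of q modulo [d] enters only through its divisibility property, so that the case d = 1,
    m = 1 is covered along with [mult_order]. *)
Lemma size_irreducible_cyclotomic_factor d m g :
  coprime d #|F| -> (0 < m)%N ->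
  (forall k, (d %| (#|F| ^ k).-1)%N = (m %| k)%N) ->
  irreducible_poly g -> g %| map_poly (intr : int -> F) 'Phi_d ->
  (size g).-1 = m.
Proof.
move=> co_d m_gt0 ord_m irr_g g_d.
have [L0 dimL [z rz genL]] := irredp_FAdjoin irr_g.
pose L := FinFieldExtType L0.
have cardL : #|L| = (#|F| ^ (size g).-1)%N.
  rewrite -dimL -(@card_vspacef F L (Vector.class L0)).
  by rewrite (@card_vspace F L (Vector.class L0)).
have prim_z : d.-primitive_root (z : L).
  apply: root_map_Cyclotomic.
    rewrite -(rmorph_nat (in_alg L0)) fmorph_eq0.
    exact: coprime_card_natr_neq0.
  have := g_d; rewrite -(dvdp_map (in_alg L0)) -map_poly_comp.
  rewrite (eq_map_poly (g := intr)); last exact: (rmorph_int (in_alg L0)).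
  by move=> /dvdpP[h ->]; rewrite rootM rz orbT.
have gm_gt0 : (0 < (size g).-1)%N.
  by case: irr_g => + _; case: (size g) => [|[]].
have z_neq0 : z != 0.
  apply/eqP => z0; have := prim_expr_order prim_z.
  rewrite z0 expr0n gtn_eqF ?(prim_order_gt0 prim_z) // => /eqP.
  by rewrite eq_sym oner_eq0.
have q_gt0 k : (0 < #|F| ^ k)%N by rewrite expn_gt0 ltnW ?finNzRing_gt1.
(* z generates F_(q^deg g) and is fixed by the m-th power of Frobenius, so that
   power is the identity; conversely z^(q^deg g) = z forces m to divide deg g. *)
have fixz k : (m %| k)%N = (z ^+ (#|F| ^ k) == z).
  rewrite -ord_m (prim_order_dvd prim_z) -[in RHS](prednK (q_gt0 k)) exprS.
  rewrite -[X in _ = (_ == X)]mulr1.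
  by rewrite (inj_eq (mulfI z_neq0)).
apply/eqP; rewrite eqn_leq andbC dvdn_leq //=; last first.
  by rewrite fixz -cardL (expf_card (z : L)).
(* Raising to the power q^m is additive, q^m being a power of the characteristic; it fixes F and
   [z], hence every polynomial in [z]. *)
have fixL (x : L) : x ^+ (#|F| ^ m) = x.
  have q_nat : [pchar L].-nat (#|F| ^ m)%N.
    by rewrite pnatX (eq_pnat _ (pchar_lalg L0)) card_pchar_nat.
  have : (x : L0) \in <<1; z>>%VS by rewrite genL memvf.
  case/Fadjoin_polyP => p /polyOverP p1 ->.
  rewrite horner_coef; apply: (big_ind (fun y : L => y ^+ (#|F| ^ m) = y)).
  - by rewrite expr0n eqn0Ngt q_gt0.
  - by move=> u v eu ev; rewrite exprDn_pchar // eu ev.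
  move=> i _; have /vlineP[c ->] := p1 i.
  have cF k : c ^+ (#|F| ^ k) = c.
    by elim: k => [|k IHk]; rewrite ?expr1 // expnSr exprM IHk expf_card.
  have /eqP zm : z ^+ (#|F| ^ m) == z by rewrite -fixz.
  have cA : (c%:A : L0) ^+ (#|F| ^ m) = c%:A.
    by rewrite -(rmorphXn (in_alg L0)) cF.
  by rewrite exprMn exprAC zm cA.
(* All of [L] consists of roots of this polynomial of degree q^m, which bounds deg g by [m]. *)
have sizeX : size ('X^(#|F| ^ m) - 'X : {poly L}) = (#|F| ^ m).+1.
  rewrite size_polyDl size_polyXn // size_polyN size_polyX ltnS.
  by rewrite -[X in (X < _)%N](expn0 #|F|) ltn_exp2l ?finNzRing_gt1.
rewrite -(leq_exp2l _ _ (finNzRing_gt1 F)) -cardL cardE -ltnS -sizeX.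
apply: max_poly_roots (enum_uniq L); first by rewrite -size_poly_gt0 sizeX.
by apply/allP => x _; rewrite rootE !hornerE fixL subrr.
Qed.

Lemma mult_orderP d k : (1 < d)%N -> coprime d #|F| ->
  (d %| (#|F| ^ k).-1)%N = (mult_order d #|F| %| k)%N.
Proof.
move=> d_gt1 co; rewrite /mult_order cyclic.order_dvdn -val_eqE.
rewrite FinRing.val_unitX FinRing.val_unit1 insubdK; last by rewrite unitZpE.
have q_gt0 : (0 < #|F| ^ k)%N by rewrite expn_gt0 ltnW ?finNzRing_gt1.
rewrite -natrX -[in RHS](prednK q_gt0) -natr1 -subr_eq0 addrK.
by rewrite -[RHS](inj_eq val_inj) /= val_Zp_nat.
Qed.

Lemma card_coprime_residues_Cyclotomic n : (0 < n)%N -> coprime n #|F| ->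
  #|coprime_residues ('X^n - 1 : {poly F})| =
    ((#|F|.-1) * \prod_(d <- divisors n | d != 1)
       (#|F| ^ mult_order d #|F|).-1 ^ (totient d %/ mult_order d #|F|))%N.
Proof.
move=> n_gt0 co; have sep := separable_Xn_sub_1_card co.
rewrite -prod_map_Cyclotomic // in sep *.
rewrite card_coprime_residues_prod // (bigD1_seq 1%N) ?divisors_uniq //=;
  last first.
  by rewrite -dvdn_divisors.
have sizeP d : (size (map_poly (intr : int -> F) 'Phi_d)).-1 = totient d.
  by rewrite size_map_poly_id0 ?size_Cyclotomic // (eqP (Cyclotomic_monic d))
    oner_neq0.
have co_dv d : (d %| n)%N -> coprime d #|F| by move/coprime_dvdl; apply.
have sepd d : (d %| n)%N -> separable_poly (map_poly (intr : int -> F) 'Phi_d).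
  move=> d_n; move: sep; rewrite (big_rem d) /= -?dvdn_divisors //.
  by rewrite separable_mul => /andP[].
congr (_ * _)%N.
  (* Phi_1 is treated apart with m = 1: [mult_order] has its intended meaning only for 1 < d. *)
  rewrite (@card_coprime_residues_equidegree _ 1) ?sepd ?dvd1n //.
    by rewrite sizeP divn1 expn1 expn1.
  move=> g irrg; apply: size_irreducible_cyclotomic_factor => //.
  - exact: coprime1n.
  - by move=> k; rewrite !dvd1n.
rewrite big_seq_cond [RHS]big_seq_cond; apply: eq_bigr => d /andP[].
rewrite -dvdn_divisors // => d_n d_neq1.
have d_gt1 : (1 < d)%N by rewrite ltn_neqAle eq_sym d_neq1 (dvdn_gt0 n_gt0).
have m_gt0 : (0 < mult_order d #|F|)%N by exact: order_gt0.
rewrite (card_coprime_residues_equidegree m_gt0) ?sepd ?sizeP // => g irrg.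
apply: size_irreducible_cyclotomic_factor => //; first exact: co_dv.
by move=> k; apply: mult_orderP => //; apply: co_dv.
Qed.

End CyclotomicFactors.

(** * Entries of circulant matrices *)

Section CirculantMatrices.
Variables (T : Type) (n : nat).
Implicit Types v : 'rV[T]_n.+1.

Lemma cirE v i j : cir v i j = v 0 (iter i (@ord_pred n.+1) j).
Proof.
rewrite mxE; elim: (i : nat) j => //= k IHk j.
by rewrite mxE IHk -iterSr.
Qed.

Lemma iter_ord_pred (j : 'I_n.+1) : iter n.+1 (@ord_pred n.+1) j = j.
Proof.
apply: val_inj.
have iterE k : iter k (@ord_pred n.+1) j = ((j + k * n) %% n.+1)%N :> nat.
  elim: k => [|k IHk] /=; first by rewrite addn0 modn_small.
  by rewrite IHk addnS /= modnDml mulSn addnCA addnC.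
apply: etrans (iterE _) _; by rewrite addnC mulnC modnMDl modn_small.
Qed.

Lemma cir_inj : injective (@cir T n.+1).
Proof.
by move=> v w /matrixP/(_ 0) e; apply/rowP => j; have := e j; rewrite !cirE.
Qed.

Lemma cir_ordS v i j : cir v (ordS i) j = cir v i (ord_pred j).
Proof.
(* From the last row [ordS] wraps to row 0, which agrees because n+1 predecessor steps form the
   identity. *)
rewrite !cirE -iterSr /=; have [->|ne] := eqVneq (i : nat) n.
  by rewrite modnn /= -iterS iter_ord_pred.
have lti : (i.+1 < n.+1)%N by rewrite ltnS ltn_neqAle ne -ltnS ltn_ord.
by rewrite modn_small.
Qed.

Lemma ordS_invariant_cir (A : 'M[T]_n.+1) :
  (forall i j, A (ordS i) j = A i (ord_pred j)) -> A = cir (row 0 A).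
Proof.
move=> AS; apply/matrixP=> i j; rewrite cirE mxE.
case: i => i lti /=; elim: i lti j => [|i IHi] lti j /=.
  by congr (A _ _); apply: val_inj.
have -> : Ordinal lti = ordS (Ordinal (ltnW lti)).
  by apply: val_inj; rewrite /= modn_small.
by rewrite AS IHi -iterSr.
Qed.

End CirculantMatrices.

Lemma cir_map (T T' : Type) n (f : T -> T') (v : 'rV[T]_n.+1) :
  cir (map_mx f v) = map_mx f (cir v).
Proof. by apply/matrixP=> i j; rewrite [RHS]mxE !cirE mxE. Qed.

(** * Circulants as polynomials in the cyclic shift matrix *)

Section CirculantAlgebra.
Variables (S : comNzRingType) (n : nat).
Implicit Types (A B : 'M[S]_n.+1) (v : 'rV[S]_n.+1).

Definition cyclic_perm : {perm 'I_n.+1} := perm (can_inj (@ordSK n.+1)).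

Definition shift_mx : 'M[S]_n.+1 := perm_mx cyclic_perm.

Lemma iter_ordS (i : 'I_n.+1) : iter i (@ordS n.+1) 0 = i.
Proof.
case: i => i /=; elim: i => [|i IHi] lti; apply: val_inj => //=.
by rewrite (IHi (ltnW lti)) /= modn_small.
Qed.

Lemma cyclic_permV j : (cyclic_perm^-1)%g j = ord_pred j.
Proof. by apply: (@perm_inj _ cyclic_perm); rewrite permKV permE ord_predK. Qed.

(** Commuting with the shift says exactly that moving one row down moves the entries one column
    right. Closure of circulants under products follows, since a centralizer is closed under
    them. *)
Lemma comm_shift_mxP A :
  comm_mx shift_mx A <-> exists v, A = cir v.
Proof.
rewrite /comm_mx /shift_mx -row_permE.
rewrite -[X in _ = _ *m perm_mx X]invgK -col_permE.
split=> [e|[v ->]].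
  exists (row 0 A); apply: ordS_invariant_cir => i j.
  by have /matrixP/(_ i j) := e; rewrite !mxE permE cyclic_permV.
apply/matrixP=> i j; rewrite [LHS]mxE [RHS]mxE permE cyclic_permV.
exact: cir_ordS.
Qed.

Lemma cir_mul v w : exists u, cir v *m cir w = cir u.
Proof.
by apply/comm_shift_mxP/comm_mxM; apply/comm_shift_mxP; eexists.
Qed.

Lemma row0_shift_mxX k :
  row 0 (shift_mx ^+ k) = delta_mx 0 (iter k (@ordS n.+1) 0).
Proof.
elim: k => [|k IHk]; first by rewrite expr0 row1.
rewrite exprSr -mulmxE row_mul IHk -rowE; apply/rowP => j.
by rewrite !mxE permE eqxx eq_sym.
Qed.

Lemma comm_shift_row0_inj A B :
  comm_mx shift_mx A -> comm_mx shift_mx B -> row 0 A = row 0 B -> A = B.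
Proof.
have row0 v : row 0 (cir v) = v by apply/rowP => j; rewrite mxE cirE.
by move=> /comm_shift_mxP[v ->] /comm_shift_mxP[w ->]; rewrite !row0 => ->.
Qed.

Lemma row0_horner_shift v : row 0 (horner_mx shift_mx (rVpoly v)) = v.
Proof.
rewrite horner_rVpoly mulmx_sum_row !linear_sum [RHS]row_sum_delta.
apply: eq_bigr => i _; rewrite rowK !linearZ /= mxvecK row0_shift_mxX.
by rewrite iter_ordS.
Qed.

(** Both sides commute with the shift, so comparing first rows suffices; the k-th power of the shift
    has the k-th basis vector as its first row for k <= n. *)
Lemma cir_horner v : cir v = horner_mx shift_mx (rVpoly v).
Proof.
apply: comm_shift_row0_inj.
- by apply/comm_shift_mxP; exists v.
- exact: comm_mx_horner.
by rewrite row0_horner_shift; apply/rowP=> j; rewrite mxE cirE.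
Qed.

Lemma shift_mx_order : horner_mx shift_mx ('X^(n.+1) - 1) = 0.
Proof.
rewrite rmorphB rmorphXn rmorph1 /= horner_mx_X; apply/eqP; rewrite subr_eq0;
  apply/eqP.
apply: comm_shift_row0_inj.
- exact: commrX.
- exact: commr1.
rewrite row0_shift_mxX row1 /= -[X in iter n _ X]/(0 : 'I_n.+1).
by congr delta_mx; apply: val_inj; rewrite /= (iter_ordS ord_max) /= modnn.
Qed.

End CirculantAlgebra.

Lemma det_cir_neq0 (F : fieldType) n (v : 'rV[F]_n.+1) :
  (\det (cir v) != 0) = coprimep (rVpoly v) ('X^(n.+1) - 1).
Proof.
rewrite -unitfE -/(unitmx (cir v)) cir_horner; set P := shift_mx F n.
set p := rVpoly v; set q := 'X^(n.+1) - 1;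
  have q0 : horner_mx P q = 0 := shift_mx_order F n.
apply/idP/idP => [unit_p|/Bezout_eq1_coprimepP[[a b] /= ab]]; last first.
  (* Evaluated at [P], the Bezout identity loses its [q] term and exhibits an inverse of p(P). *)
  have := congr1 (horner_mx P) ab.
  rewrite rmorphD !rmorphM rmorph1 /= q0 mulr0 addr0.
  by case/mulmx1_unit.
(* A common factor g makes cir v a zero divisor: it kills h(P), where
   X^n - 1 = h g, and h(P) != 0 because deg h < n. *)
rewrite /coprimep; apply: contraT => g1.
have szq : size q = n.+2 by rewrite size_XnsubC.
have qn0 : q != 0 by rewrite -size_poly_gt0 szq.
have [g_p g_q] := (dvdp_gcdl p q, dvdp_gcdr p q).
set g := gcdp p q in g1 g_p g_q.
case/dvdpP: g_p => w def_p; case/dvdpP: g_q => h def_q.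
have: horner_mx P p *m horner_mx P h = 0.
  by rewrite mulmxE -rmorphM def_p mulrAC -mulrA -def_q rmorphM /= q0 mulr0.
move/(congr1 (mulmx (invmx (horner_mx P p)))); rewrite mulKmx // mulmx0 => h0.
have gn0 : g != 0 by apply: contraNneq qn0 => g0; rewrite def_q g0 mulr0.
have hn0 : h != 0 by apply: contraNneq qn0 => g0; rewrite def_q g0 mul0r.
have szh : (size h <= n.+1)%N.
  have := szq; rewrite def_q size_mul //; move: g1;
    rewrite -size_poly_gt0 in gn0.
  by case: (size g) gn0 => [|[|s]] // _ _; rewrite !addnS /= => -[<-];
    rewrite leq_addr.
(* The first row of h(P) lists the coefficients of [h], so h(P) = 0 would force h = 0. *)
have := row0_horner_shift (poly_rV h : 'rV_n.+1).
rewrite poly_rV_K // h0 row0 => /(congr1 (@rVpoly _ _)).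
by rewrite linear0 poly_rV_K // => h00; rewrite -h00 eqxx in hn0.
Qed.

(** Each fibre over a point of [B] is a translate of the kernel. *)
Lemma card_preim_zmod_morphism (U V : finZmodType) (h : U -> V) (B : {set V}) :
  zmod_morphism h -> (forall y, y \in B -> exists x, h x = y) ->
  #|h @^-1: B| = (#|h @^-1: [set 0%R]| * #|B|)%N.
Proof.
move=> hB imB; rewrite -sum1_card (partition_big h (mem B)) /=; last first.
  by move=> x; rewrite inE.
rewrite mulnC -sum_nat_const; apply: eq_bigr => y By.
have [x0 hx0] := imB y By.
rewrite sum1_card -(card_imset (h @^-1: _) (addrI x0)); apply: eq_card => x.
rewrite -{2}(subrKC x0 x) mem_imset ?inE; last exact: addrI.
rewrite hB hx0 subr_eq0 [LHS]unfold_in /= inE.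
by case: eqP => [->|]; rewrite ?By ?andbF.
Qed.

Lemma det_add_const_mx (S : comNzRingType) n (a : S) :
  \det (1%:M + const_mx a : 'M[S]_n) = 1 + a *+ n.
Proof.
pose u : 'cV[S]_n := const_mx a; pose r : 'rV[S]_n := const_mx 1.
have -> : const_mx a = u *m r.
  by apply/matrixP=> i j; rewrite !mxE big_ord1 !mxE mulr1.
(* Sylvester's identity det (1 + u r) = det (1 + r u), by factoring one block
   matrix in two ways. *)
have e1 : block_mx 1%:M (- u) r (1%:M : 'M_1)
    = block_mx 1%:M 0 r 1%:M *m block_mx 1%:M (- u) 0 (1%:M + r *m u).
  rewrite mulmx_block !(mul1mx, mulmx1, mul0mx, mulmx0, addr0) mulmxN.
  by rewrite addrCA addNr addr0.
have e2 : block_mx 1%:M (- u) r (1%:M : 'M_1)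
    = block_mx (1%:M + u *m r) (- u) 0 1%:M *m block_mx 1%:M 0 r 1%:M.
  rewrite mulmx_block !(mul1mx, mulmx1, mul0mx, mulmx0, addr0, add0r) mulNmx.
  by rewrite addrK.
have := congr1 determinant e1; rewrite e2 !det_mulmx !det_lblock !det_ublock.
rewrite !det1 !mulr1 !mul1r => ->; rewrite det_mx11 !mxE.
congr (_ + _); rewrite (eq_bigr (fun=> a)) ?sumr_const ?card_ord // => i _.
by rewrite !mxE mul1r.
Qed.

(** * Equal frequency of the unit determinants *)

Section CirculantCount.
Variables (R : finComNzRingType) (n : nat).

Lemma cir_add_const (a : R) : exists v : 'rV[R]_n.+1, 1%:M + const_mx a = cir v.
Proof.
apply/comm_shift_mxP; apply: comm_mxD; first exact: comm_mx1.
apply/comm_shift_mxP; exists (const_mx a).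
by apply/matrixP=> i j; rewrite cirE !mxE.
Qed.

(** Multiplication by a circulant of determinant [u] maps circulants of determinant [a] injectively
    to circulants of determinant [a * u]. *)
Lemma leq_circulant_count_unit (t a u w : R) :
  n.+1%:R * t = 1 -> u * w = 1 ->
  (circulant_count n.+1 a <= circulant_count n.+1 (a * u)%R)%N.
Proof.
move=> nt uw; pose U : 'M[R]_n.+1 := 1%:M + const_mx ((u - 1) * t).
have detU : \det U = u.
  by rewrite det_add_const_mx -mulr_natl mulrCA nt mulr1 addrC subrK.
have U_inj : injective (fun A : 'M[R]_n.+1 => A *m U).
  (* [w *: \adj U] inverts [U], whose determinant is [u]. *)
  apply: (can_inj (g := fun A => w *: (A *m \adj U))) => A.
  by rewrite -mulmxA mul_mx_adj detU mul_mx_scalar scalerA mulrC uw scale1r.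
rewrite /circulant_count -(card_imset _ U_inj); apply/subset_leq_card/subsetP.
move=> _ /imsetP[A + ->]; rewrite !inE => /andP[/codomP[v ->] /eqP detA].
rewrite det_mulmx detA detU eqxx andbT.
have [w' ew'] := cir_add_const ((u - 1) * t); rewrite /U ew'.
by have [x ->] := cir_mul v w'; apply: codom_f.
Qed.

Lemma circulant_count_unit (t u w : R) : n.+1%:R * t = 1 -> u * w = 1 ->
  circulant_count n.+1 u = circulant_count n.+1 (1 : R).
Proof.
move=> nt uw; apply/eqP; rewrite eqn_leq.
have := leq_circulant_count_unit 1 nt uw; rewrite mul1r => ->; rewrite andbT.
rewrite mulrC in uw; rewrite -[X in (_ <= circulant_count _ X)%N]uw mulrC.
exact: leq_circulant_count_unit nt uw.
Qed.

End CirculantCount.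

(** * Orders of the chain ring and its ideals, and reduction to the residue field *)

Section ChainRing.
Variables (R : finComNzRingType) (F : finFieldType) (f : {rmorphism R -> F}).
Variables (gamma : R) (e : nat).
Hypothesis f_surj : forall y, exists x, f x = y.
Hypothesis f_ker : forall x, (f x == 0) = (x \in principal gamma).
Hypothesis e_nilp : nilpotency_index gamma e.

Lemma chain_unit x : f x != 0 -> exists y, x * y = 1.
Proof.
move=> fx0; have [y fy] := f_surj (f x)^-1.
have : f (1 - x * y) == 0 by rewrite rmorphB rmorphM rmorph1 fy divff // subrr.
rewrite f_ker => /imsetP[z _ ez].
have [_ ge0 _] := e_nilp.
(* Here [x * y = 1 - gamma * z] with [gamma * z] nilpotent, so a finite geometric series inverts
   it. *)
exists (y * \sum_(i < e) (gamma * z) ^+ i).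
rewrite mulrA -[x * y](subKr 1) ez.
have := subrX1 (gamma * z) e; rewrite exprMn ge0 mul0r sub0r => /(congr1 -%R).
by rewrite opprK -mulNr opprB => <-.
Qed.

Lemma gammaX_neq0 i : (i < e)%N -> gamma ^+ i != 0.
Proof.
case: e_nilp => _ _ e_min lti; case: i lti => [|i] lti;
  first by rewrite expr0 oner_neq0.
by apply: contraTneq lti => /(e_min i.+1 isT); rewrite -leqNgt.
Qed.

(** If [gamma ^+ i * x = gamma ^+ i.+1 * y] with [f x != 0], then [x - gamma * y] is a unit killing
    [gamma ^+ i], which is nonzero for i < e. *)
Lemma gammaX_ker i x : (i < e)%N ->
  (gamma ^+ i * x \in principal (gamma ^+ i.+1)) = (f x == 0).
Proof.
move=> lti; apply/imsetP/idP => [[y _ exy]|]; last first.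
  by rewrite f_ker => /imsetP[y _ ->]; exists y => //; rewrite exprSr mulrA.
have fg : f gamma = 0 by apply/eqP; rewrite f_ker; apply/imsetP; exists 1;
  rewrite ?mulr1.
apply: contraTT (gammaX_neq0 lti) => fx; rewrite negbK.
have /chain_unit[z xz] : f (x - gamma * y) != 0.
  by rewrite rmorphB rmorphM fg mul0r subr0.
by rewrite -[_ ^+ _]mulr1 -xz mulrA mulrBr exy exprSr -mulrA subrr mul0r.
Qed.

Lemma card_chain_quotient : #|R| = (#|f @^-1: [set 0%R]| * #|F|)%N.
Proof.
rewrite -(cardsT F) -(card_preim_zmod_morphism (raddfB f)) //.
by rewrite preimsetT cardsT.
Qed.

(* Multiplication by gamma^i maps R onto (gamma^i) and the maximal ideal onto
   (gamma^(i+1)), with the same kernel. *)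
Lemma card_principal_gammaX i : (i <= e)%N ->
  #|R| = (#|F| ^ i * #|principal (gamma ^+ i)|)%N.
Proof.
elim: i => [|i IHi] lti.
  rewrite expr0 mul1n; apply: eq_card => x.
  by symmetry; apply/imsetP; exists x; rewrite ?mul1r.
have hB : zmod_morphism ( *%R (gamma ^+ i)) by move=> x y; rewrite mulrBr.
have im j : j \in principal (gamma ^+ i) -> exists x, gamma ^+ i * x = j.
  by case/imsetP => x _ ->; exists x.
have c1 := card_preim_zmod_morphism hB im.
have c2 := @card_preim_zmod_morphism _ _ _ (principal (gamma ^+ i.+1)) hB.
move: c1; set K := #|_ @^-1: [set 0%R]| in c2 * => c1.
have K_gt0 : (0 < K)%N by rewrite card_gt0; apply/set0Pn; exists 0;
  rewrite !inE mulr0.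
have e1 : #|R| = (K * #|principal (gamma ^+ i)|)%N.
  rewrite -c1 -cardsT; apply: eq_card => x; rewrite !inE.
  by symmetry; apply/imsetP; exists x.
have e2 : #|f @^-1: [set 0%R]| = (K * #|principal (gamma ^+ i.+1)|)%N.
  rewrite -c2; first by apply: eq_card => x; rewrite !inE gammaX_ker.
  by move=> j /imsetP[x _ ->]; exists (gamma * x); rewrite mulrA exprSr.
rewrite (IHi (ltnW lti)) expnSr -mulnA; congr (_ * _)%N.
apply/eqP; rewrite -(eqn_pmul2l K_gt0) -e1 card_chain_quotient e2.
by rewrite -mulnA [(_ * #|F|)%N]mulnC.
Qed.

Lemma card_chain_ring : #|R| = (#|F| ^ e)%N.
Proof.
have [_ ge0 _] := e_nilp.
rewrite (card_principal_gammaX (leqnn e)) ge0.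
have -> : principal (0 : R) = [set 0%R].
  apply/setP => x; rewrite inE; apply/imsetP/eqP => [[y _ ->]|->];
    first by rewrite mul0r.
  by exists 0; rewrite ?mulr0.
by rewrite cards1 muln1.
Qed.

Lemma card_chain_maximal : #|f @^-1: [set 0%R]| = (#|F| ^ e.-1)%N.
Proof.
have [e_gt0 _ _] := e_nilp.
have q_gt0 : (0 < #|F|)%N by rewrite ltnW ?finNzRing_gt1.
apply/eqP; rewrite -(eqn_pmul2r q_gt0) -card_chain_quotient card_chain_ring.
by rewrite -expnSr prednK.
Qed.

Lemma card_chain_units : #|[set x | f x != 0]| = (#|F| ^ e.-1 * #|F|.-1)%N.
Proof.
have -> : [set x | f x != 0] = f @^-1: (~: [set 0%R]) by apply/setP=> x;
  rewrite !inE.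
rewrite (card_preim_zmod_morphism (h := f)) ?cardsC1 ?card_chain_maximal //.
exact: raddfB.
Qed.

Lemma card_nonsingular_cir n :
  #|[set v : 'rV[R]_n.+1 | f (\det (cir v)) != 0]|
    = ((#|F| ^ e.-1) ^ n.+1 * #|[set w : 'rV[F]_n.+1 | \det (cir w) != 0%R]|)%N.
Proof.
have hB : zmod_morphism (map_mx f : 'rV[R]_n.+1 -> 'rV[F]_n.+1).
  by move=> v w; rewrite map_mxB.
have h_surj (w : 'rV[F]_n.+1) : exists v, map_mx f v = w.
  have [g fg] := fin_all_exists (fun j => f_surj (w 0 j)).
  by exists (\row_j g j); apply/rowP => j; rewrite !mxE fg.
have h_preim B := @card_preim_zmod_morphism _ _ _ B hB (fun w _ => h_surj w).
have -> : [set v : 'rV[R]_n.+1 | f (\det (cir v)) != 0]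
    = map_mx f @^-1: [set w | \det (cir w) != 0].
  by apply/setP=> v; rewrite !inE cir_map det_map_mx.
rewrite h_preim; congr (_ * _)%N.
have [e_gt0 _ _] := e_nilp.
have q_gt0 k : (0 < #|F| ^ k)%N by rewrite expn_gt0 ltnW ?finNzRing_gt1.
(* The kernel of reduction on rows is found by comparing the full row spaces: |R|^(n+1) = |ker|
   q^(n+1). *)
apply/eqP; rewrite -(eqn_pmul2r (q_gt0 n.+1)).
have := h_preim [set: 'rV[F]_n.+1]; rewrite !cardsT card_mx mul1n => <-.
rewrite -expnMn -expnSr prednK // -card_chain_ring.
by rewrite -[X in (_ ^ X)%N]mul1n -card_mx preimsetT cardsT.
Qed.

(** The circulants with unit determinant are partitioned by the value of that determinant, and all
    classes have the same size. *)
Lemma circulant_count_nonsingular n (t : R) : n.+1%:R * t = 1 ->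
  #|[set v : 'rV[R]_n.+1 | f (\det (cir v)) != 0]|
    = (#|[set x | f x != 0%R]| * circulant_count n.+1 (1%R : R))%N.
Proof.
move=> nt; rewrite -sum1_card.
rewrite (partition_big (fun v => \det (cir v)) (mem [set x | f x != 0])) /=;
  last first.
  by move=> v; rewrite !inE.
rewrite -sum_nat_const; apply: eq_bigr => u; rewrite inE => fu.
have [w uw] := chain_unit fu; rewrite -(circulant_count_unit nt uw).
rewrite sum1_card /circulant_count -(card_imset _ (@cir_inj R n)).
apply: eq_card => A; rewrite inE; apply/imsetP/andP.
  by case=> v; rewrite unfold_in /= => /andP[_ /eqP <-] ->; rewrite codom_f.
case=> /codomP[v ->] /eqP detv; exists v => //.
by rewrite unfold_in /= inE detv fu eqxx.
Qed.

Lemma circulant_count1 n : coprime n.+1 #|F| ->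
  circulant_count n.+1 (1 : R)
    = ((#|F| ^ e.-1) ^ n * \prod_(d <- divisors n.+1 | d != 1)
       (#|F| ^ mult_order d #|F|).-1 ^ (totient d %/ mult_order d #|F|))%N.
Proof.
move=> co.
have [t nt] : exists t, n.+1%:R * t = 1 :> R.
  by apply: chain_unit; rewrite rmorph_nat coprime_card_natr_neq0.
have := circulant_count_nonsingular nt; rewrite card_nonsingular_cir
  card_chain_units.
have szX : (size ('X^(n.+1) - 1 : {poly F})).-1 = n.+1 by rewrite size_XnsubC.
have -> : [set w : 'rV[F]_n.+1 | \det (cir w) != 0]
    = [set w | coprimep (rVpoly w) ('X^(n.+1) - 1)].
  by apply/setP => w; rewrite !inE det_cir_neq0.
have := card_coprime_residues_Cyclotomic (ltn0Sn n) co.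
rewrite /coprime_residues szX => ->.
(* The common factor |R^*| = q^(e-1) (q-1) is cancelled: one of the n+1 powers q^(e-1) and the Phi_1
   factor q - 1 supply it. *)
set P := (\prod_(d <- _ | _) _)%N; rewrite expnS mulnACA mulnA => e1.
have q_gt1 := finNzRing_gt1 F.
have Q_gt0 : (0 < #|F| ^ e.-1 * #|F|.-1)%N.
  by rewrite muln_gt0 expn_gt0 (ltnW q_gt1) -(subnKC q_gt1).
by apply/eqP; rewrite -(eqn_pmul2l Q_gt0) -e1 mulnA.
Qed.

End ChainRing.

(** * From the natural-number count to the rational formula *)

Lemma dvdn_mult_order_totient d q : (1 < d)%N ->
  (mult_order d q %| totient d)%N.
Proof.
by move=> d_gt1; rewrite -card_units_Zp 1?ltnW // cyclic.order_dvdG ?inE.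
Qed.

Lemma sum_totient_divisors n : (0 < n)%N ->
  (\sum_(d <- divisors n) totient d)%N = n.
Proof.
move=> n_gt0; rewrite -[RHS]cyclic.sum_totient_dvd.
rewrite -(big_mkord (fun d => d %| n)%N totient) -[RHS]big_filter.
apply/perm_big/uniq_perm; rewrite ?divisors_uniq ?filter_uniq ?iota_uniq //.
move=> d; rewrite -dvdn_divisors // mem_filter mem_index_iota ltnS /=.
by apply/idP/andP => [d_n|[]//]; rewrite d_n dvdn_leq.
Qed.

Theorem theorem4p6
  (R : finComNzRingType) (R_chain : chain_ring R)
  (M : idealr R) (M_max : maximal_ideal [set x : R | x \in M])
  (gamma : R) (M_gamma : [set x : R | x \in M] = principal gamma)
  (e : nat) (e_nilp : nilpotency_index gamma e)
  (q : nat) (F : finFieldType) (F_card : #|F| = q)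
  (residue_field : exists f : {rmorphism {ideal_quot M} -> F}, bijective f)
  (n : nat) (n_gt0 : (0 < n)%N) (n_q : coprime n q) :
  (circulant_count n (1 : R))%:R =
    q%:R ^+ (e * (n - 1)) *
    \prod_(d <- divisors n | d != 1%N)
      (1 - q%:R ^- mult_order d q) ^+ (totient d %/ mult_order d q) :> rat.
Proof.
case: residue_field => f [g fK gK].
(* The reduction map: a surjection onto F with kernel generated by [gamma]. *)
pose h : {rmorphism R -> F} := f \o \pi_{ideal_quot M}%qT.
have h_surj y : exists x, h x = y.
  by exists (generic_quotient.repr (g y)); rewrite /= generic_quotient.reprK gK.
have h_ker x : (h x == 0) = (x \in principal gamma).
  rewrite -M_gamma inE /= -(rmorph0 f) (inj_eq (can_inj fK)).
  by rewrite -[X in _ == X](rmorph0 (\pi_{ideal_quot M}%qT)) -Quotient.idealrBE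
    subr0.
case: n n_gt0 n_q => // n _; rewrite -F_card => n_q.
rewrite (circulant_count1 h_surj h_ker e_nilp n_q) subn1 /=.
have [e_gt0 _ _] := e_nilp; set Q := #|F|.
have Q_gt0 : (0 < Q)%N by rewrite ltnW ?finNzRing_gt1.
have Qn0 : Q%:R != 0 :> rat by rewrite Num.Theory.pnatr_eq0 -lt0n.
rewrite natrM natrX natrX -exprM -{2}(prednK e_gt0) mulSn addnC exprD -mulrA.
congr (_ * _).
(* The matrix size is now [n.+1]. The remaining factor q^n is spread over the divisors d != 1 as the
   product of the q^phi(d). *)
have sumn : n = (\sum_(d <- divisors n.+1 | d != 1) totient d)%N.
  apply: succn_inj; rewrite -[LHS](sum_totient_divisors (ltn0Sn n)).
  by rewrite (bigD1_seq 1%N) ?divisors_uniq -?dvdn_divisors.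
rewrite [X in _ = _ ^+ X * _]sumn -prodrXr -big_split natr_prod /= big_seq_cond
  [RHS]big_seq_cond.
apply: eq_bigr => d /andP[]; rewrite -dvdn_divisors // => d_n d1.
have d_gt1 : (1 < d)%N by rewrite ltn_neqAle eq_sym d1 (dvdn_gt0 _ d_n).
(* With m the order of q modulo [d], q^phi(d) = (q^m)^(phi(d)/m) by exact division, and q^m (1 -
   q^-m) = q^m - 1. *)
rewrite -{2}(divnK (dvdn_mult_order_totient Q d_gt1)) mulnC exprM -exprMn.
rewrite natrX mulrBr mulr1 divff ?expf_neq0 // -subn1 natrB ?natrX //.
by rewrite expn_gt0 Q_gt0.
Qed.
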